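(* Let $\mathbb{F}$ be a field with $\operatorname{char}\mathbb{F}\neq 2,3$, and let $\mathfrak{g}$ be a finite-dimensional classical simple Lie algebra over $\mathbb{F}$ with non-degenerate Killing form. Then every symmetric biderivation $\delta:\mathfrak{g}\times\mathfrak{g}\to\mathfrak{g}$ is trivial, i.e. $\delta(x,y)=0$ for all $x,y\in\mathfrak{g}$.
   Context: For a Lie algebra $L$ over a field $\mathbb{F}$, a biderivation of $L$ is an $\mathbb{F}$-bilinear map $\delta:L\times L\to L$ such that for all $x,y,z\in L$: $\delta([x,y],z)=[x,\delta(y,z)]-[y,\delta(x,z)]$ and $\delta(x,[y,z])=[\delta(x,y),z]+[y,\delta(x,z)]$. It is a symmetric biderivation if moreover $\delta(x,y)=\delta(y,x)$ for all $x,y\in L$. Convention on classical simple Lie algebras: $\mathfrak{g}$ is simple and finite-dimensional over $\mathbb{F}$; with respect to a fixed Cartan subalgebra $\mathfrak{h}$ it has a root space decomposition $\mathfrak{g}=\mathfrak{h}\oplus\bigoplus_{\alpha\in\Phi}\mathfrak{g}_\alpha$, where $\Phi\subset\mathfrak{h}^*$ is the root system determined by $\mathfrak{h}$ and each root space $\mathfrak{g}_\alpha$ ($\alpha\in\Phi$) is one-dimensional; and, with $\Phi_+$ the set of positive roots and $\Pi$ the set of simple roots, $\mathfrak{g}$ has a Chevalley basis $\{e_\alpha,f_\alpha,h_\beta\mid\alpha\in\Phi_+,\beta\in\Pi\}$. *)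

(* Defs.v *)
From HB Require Import structures.
From mathcomp Require Import all_boot all_order all_algebra.

Set Implicit Arguments.
Unset Strict Implicit.
Unset Printing Implicit Defensive.

Import Order.TTheory GRing.Theory Num.Theory.
Local Open Scope ring_scope.

HB.mixin Record Vector_isLieAlgebra (F : fieldType) g of Vector F g := {
  lie : g -> g -> g;
  lie_is_bilinear : bilinear_for *:%R *:%R lie;
  liexx : forall x, lie x x = 0;
  lie_jacobi : forall x y z,
    lie x (lie y z) + lie y (lie z x) + lie z (lie x y) = 0
}.

#[short(type="lieAlgType")]
HB.structure Definition LieAlgebra (F : fieldType) :=
  {g of Vector_isLieAlgebra F g & Vector F g}.

Notation "[ 'Lie' x , y ]" := (lie x y)
  (at level 0, x, y at level 99, format "[ 'Lie'  x ,  y ]") : ring_scope.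

HB.instance Definition _ (F : fieldType) (g : lieAlgType F) :=
  bilinear_isBilinear.Build F g g g *:%R *:%R (@lie F g) lie_is_bilinear.

HB.instance Definition _ (F : fieldType) (g : lieAlgType F) (x : g) :=
  GRing.isLinear.Build F g g *:%R (lie x) (lie_is_bilinear.2 x).

Section LieAlgebraTheory.
Variables (F : fieldType) (g : lieAlgType F).
Implicit Types (x y z : g) (H I : {vspace g}) (n : nat).

Definition ad x : 'End(g) := linfun (lie x).

Lemma adE x y : ad x y = [Lie x, y].
Proof. exact: lfunE. Qed.

Definition killing x y : F :=
  \tr (passmx.mxof (vbasis {:g}) (vbasis {:g}) (ad x \o ad y)%VF).

Definition killing_nondegenerate : Prop :=
  forall x, (forall y, killing x y = 0) -> x = 0.

Definition lie_ideal I : Prop := forall x y, y \in I -> [Lie x, y] \in I.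

Definition simple_lie : Prop :=
  (exists x y, [Lie x, y] != 0) /\
  (forall I, lie_ideal I -> I = 0%VS \/ I = fullv).

Definition lie_subalgebra H : Prop :=
  forall x y, x \in H -> y \in H -> [Lie x, y] \in H.

Definition lie_span H I : {vspace g} :=
  <<[seq [Lie x, y] | x <- vbasis H, y <- vbasis I]>>%VS.

Definition lower_central H n : {vspace g} := iter n (lie_span H) H.

Definition cartan_subalgebra H : Prop :=
  [/\ lie_subalgebra H,
      exists n, lower_central H n = 0%VS
    & forall x, (forall y, y \in H -> [Lie x, y] \in H) -> x \in H].

Definition root_space H (a : 'Hom(subvs_of H, F^o)) : {vspace g} :=
  (\bigcap_(t <- vbasis {: subvs_of H})
     passmx.leigenspace (ad (vsval t)) (a t))%VS.

Lemma root_spaceP H (a : 'Hom(subvs_of H, F^o)) x :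
  reflect (forall t : subvs_of H, [Lie vsval t, x] = (a t : F) *: x)
          (x \in root_space a).
Proof.
have eigP (t : subvs_of H) : (x \in passmx.leigenspace (ad (vsval t)) (a t)) =
    ([Lie vsval t, x] == (a t : F) *: x).
  by rewrite memv_ker add_lfunE opp_lfunE scale_lfunE id_lfunE adE subr_eq0.
have -> : (x \in root_space a) =
    all (fun t => [Lie vsval t, x] == (a t : F) *: x) (vbasis {: subvs_of H}).
  rewrite /root_space; elim: (tval _) => [|t s IHs] /=.
    by rewrite big_nil memvf.
  by rewrite big_cons memv_cap IHs eigP.
apply: (iffP allP) => [ax t|ax t _]; last exact/eqP.
rewrite (coord_vbasis (memvf t)) !linear_sum linear_sumlz scaler_suml /=.
apply: eq_bigr => i _; rewrite !linearZ linearZl_LR /=.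
by rewrite (eqP (ax _ _)) ?scalerA // mem_nth // size_tuple.
Qed.

Definition is_root H (a : 'Hom(subvs_of H, F^o)) : bool :=
  (a != 0) && (root_space a != 0%VS).

Definition root_decomposition H (Phi : seq 'Hom(subvs_of H, F^o)) : Prop :=
  [/\ uniq Phi,
      Phi =i @is_root H,
      directv (H + \sum_(a <- Phi) root_space a),
      (H + \sum_(a <- Phi) root_space a)%VS = fullv
    & {in Phi, forall a, \dim (root_space a) = 1%N}].

End LieAlgebraTheory.

(* Reduced root systems in the sense of Bourbaki; coroot a b is <b, a^vee>.   *)
Record rootSystem (V : vectType rat) := RootSystem {
  roots :> seq V;
  coroot : V -> 'Hom(V, rat^o);
  roots_uniq : uniq roots;
  roots_span : <<roots>>%VS = fullv;
  roots_neq0 : 0 \notin roots;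
  coroot_id : {in roots, forall a, coroot a a = 2 :> rat};
  roots_reflection :
    {in roots &, forall a b, b - (coroot a b : rat) *: a \in roots};
  coroot_int : {in roots &, forall a b, (coroot a b : rat) \is a Num.int};
  roots_reduced :
    {in roots, forall a (c : rat), c *: a \in roots -> c = 1 \/ c = -1}
}.

Section RootSystemTheory.
Variables (V : vectType rat) (R : rootSystem V) (l : nat) (Pi : l.-tuple V).

Definition positive_root (a : V) : bool :=
  (a \in roots R) && [forall i, coord Pi i a \is a Num.nat].

Definition positive_roots : seq V := [seq a <- roots R | positive_root a].

Definition simple_roots : Prop :=
  [/\ basis_of fullv Pi,
      {subset Pi <= roots R}
    & {in roots R, forall a, positive_root a \/ positive_root (- a)}].

(* b - r a, ..., b is the lower part of the a-string through b. *)
Definition root_string_down (a b : V) (r : nat) : Prop :=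
  b - r%:R *: a \in roots R /\
  forall k : nat, (r < k)%N -> b - k%:R *: a \notin roots R.

End RootSystemTheory.

(* The roots of H are functions with values in F, so when F has positive      *)
(* characteristic positivity and root strings make no sense for them.  They   *)
(* are therefore labelled, through wt, by a root system R over the rationals. *)
(* For a positive, e_a is x a and f_a is x (- a).  The scalars ratr _ below   *)
(* are images of integers, by coroot_int.                                     *)
Record chevalley_basis (F : fieldType) (g : lieAlgType F) (H : {vspace g})
    (V : vectType rat) (R : rootSystem V) (l : nat) (Pi : l.-tuple V)
    (wt : V -> 'Hom(subvs_of H, F^o)) (x : V -> g) (h : 'I_l -> g) : Prop := {
  chev_basis : basis_of fullv ([seq x a | a <- positive_roots R Pi] ++
                               [seq x (- a) | a <- positive_roots R Pi] ++
                               [seq h i | i <- enum 'I_l]);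
  chev_root_vector : {in roots R, forall a, x a \in root_space (wt a)};
  chev_cartan : forall i, h i \in H;
  chev_hh : forall i j, [Lie h i, h j] = 0;
  chev_hx : forall i, {in roots R, forall a,
    [Lie h i, x a] = ratr (coroot R Pi`_i a) *: x a};
  chev_xN : {in roots R, forall a, exists2 c : 'I_l -> int,
    coroot R a = \sum_(i < l) coroot R Pi`_i *~ c i
    & [Lie x a, x (- a)] = \sum_(i < l) h i *~ c i};
  chev_xx : {in roots R &, forall a b, a + b \in roots R ->
    forall r : nat, root_string_down R a b r ->
    [Lie x a, x b] = r.+1%:R *: x (a + b) \/
    [Lie x a, x b] = - (r.+1%:R *: x (a + b))};
  chev_xx0 : {in roots R &, forall a b, a + b != 0 -> a + b \notin roots R ->
    [Lie x a, x b] = 0}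
}.

Definition classical_simple (F : fieldType) (g : lieAlgType F) : Prop :=
  simple_lie g /\
  exists (H : {vspace g}) (Phi : seq 'Hom(subvs_of H, F^o))
         (V : vectType rat) (R : rootSystem V) (l : nat) (Pi : l.-tuple V)
         (wt : V -> 'Hom(subvs_of H, F^o)) (x : V -> g) (h : 'I_l -> g),
    [/\ cartan_subalgebra H,
        root_decomposition Phi,
        perm_eq [seq wt a | a <- roots R] Phi,
        simple_roots R Pi
      & chevalley_basis R Pi wt x h].

Section Biderivations.
Variables (F : fieldType) (g : lieAlgType F).
Implicit Type delta : {bilinear g -> g -> g}.

Definition biderivation delta : Prop :=
  (forall x y z, delta [Lie x, y] z =
                 [Lie x, delta y z] - [Lie y, delta x z]) /\
  (forall x y z, delta x [Lie y, z] =
                 [Lie delta x y, z] + [Lie y, delta x z]).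

Definition symmetric_biderivation delta : Prop :=
  biderivation delta /\ forall x y, delta x y = delta y x.

End Biderivations.

(* Main.v *)
Require Import Defs.
From HB Require Import structures.
From mathcomp Require Import all_boot all_order all_algebra.

Import GRing.Theory passmx.
Local Open Scope ring_scope.

(** The Killing form kappa is invariant under every derivation D, since
    ad (D y) = [D, ad y] and traces of commutators vanish.  As delta(x, .) is a
    derivation, kappa(delta(x, y), z) is antisymmetric in y and z; it is also
    symmetric in x and y, and a trilinear form with both properties vanishes in
    characteristic different from 2. *)

Lemma mxtrace_mxof_compC {F : fieldType} {vT : vectType F}
    (e : (\dim {:vT}).-tuple vT) (f k : 'End(vT)) : basis_of fullv e ->
  \tr (mxof e e (f \o k)%VF) = \tr (mxof e e (k \o f)%VF).
Proof. by move=> e_basis; rewrite !(mxof_comp _ _ e_basis) mxtrace_mulC. Qed.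

Section KillingForm.
Context {F : fieldType} {g : lieAlgType F}.
Implicit Types (x y z : g) (D : 'End(g)).

Lemma killingC y z : killing y z = killing z y.
Proof. exact: mxtrace_mxof_compC (vbasisP _). Qed.

Lemma ad_derivation {D} :
    (forall y z, D [Lie y, z] = [Lie D y, z] + [Lie y, D z]) ->
  forall y, ad (D y) = ((D \o ad y) - (ad y \o D))%VF.
Proof.
move=> derD y; apply/lfunP=> z.
by rewrite add_lfunE opp_lfunE !comp_lfunE !adE derD addrK.
Qed.

Lemma killing_derivation {D} :
    (forall y z, D [Lie y, z] = [Lie D y, z] + [Lie y, D z]) ->
  forall y z, killing (D y) z = - killing y (D z).
Proof.
move=> derD y z; rewrite /killing !(ad_derivation derD).
rewrite comp_lfunDl comp_lfunDr comp_lfunNl comp_lfunNr !linearB /= opprB.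
(* Both sides contain the trace of [ad y \o D \o ad z] with a minus sign; the remaining terms agree
   after moving [D] cyclically. *)
by rewrite !comp_lfunA -(comp_lfunA D) (mxtrace_mxof_compC _ D) ?vbasisP.
Qed.

End KillingForm.

(** The two swaps compose to a 3-cycle of the arguments that changes the sign; its cube is the
    identity with sign -1, hence [f x y z = - f x y z]. *)
Lemma sym_antisym_eq0 {T : Type} {F : fieldType} (f : T -> T -> T -> F) :
    2%N \notin [pchar F] ->
    (forall x y z, f x y z = f y x z) ->
    (forall x y z, f x y z = - f x z y) ->
  forall x y z, f x y z = 0.
Proof.
move=> F2 fC fN x y z.
have fE : f x y z = - f x y z.
  by rewrite {1}fN fC fN opprK fC fN fC.
have /eqP : f x y z *+ 2 = 0 by rewrite mulr2n {2}fE subrr.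
rewrite -mulr_natr mulf_eq0 => /orP[/eqP // | F2_0].
by rewrite inE /= F2_0 in F2.
Qed.

Theorem theorem3p2 (F : fieldType) (hF2 : 2%N \notin [pchar F])
    (hF3 : 3%N \notin [pchar F]) (g : lieAlgType F)
    (hg : classical_simple g) (hK : killing_nondegenerate g)
    (delta : {bilinear g -> g -> g}) (hdelta : symmetric_biderivation delta) :
  forall x y : g, delta x y = 0.
Proof.
have [[_ derR] deltaC] := hdelta.
move=> x y; apply: hK => z.
apply: (sym_antisym_eq0 (fun x y z => killing (delta x y) z) hF2) => {x y z} x y z.
  by rewrite deltaC.
have derD : forall u v, linfun (delta x) [Lie u, v] =
    [Lie linfun (delta x) u, v] + [Lie u, linfun (delta x) v].
  by move=> u v; rewrite !lfunE /= derR.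
(* Moving [delta x] across [killing] leaves it on the second argument; symmetry of [killing] brings
   it back to the first. *)
by have := killing_derivation derD y z; rewrite !lfunE /= (killingC y).
Qed.
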